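(* Let $\mathcal A\in R$. Suppose there exists a lower triangular tensor $\mathcal L\in R$ such that $\mathcal A*\mathcal A^T=\mathcal L*\mathcal L^T$ and $\mathcal L^T*\mathcal L$ is invertible. Then $$\mathcal A^\dagger=\mathcal A^T*\mathcal L*(\mathcal L^T*\mathcal L)^{-2}*\mathcal L^T .$$
   Context: Fix $p\ge 3$ and positive integers $n,n_3,\dots,n_p$; $R=\mathbb{R}^{n\times n\times n_3\times\cdots\times n_p}$ is the set of real tensors of this size, with entrywise addition. For $\mathcal A\in R$ let $\mathcal A_i$ ($1\le i\le n_p$) be the tensor of order $p-1$ obtained by fixing the last index at $i$. The t-product is defined recursively by $(\mathcal A*\mathcal B)_i=\sum_{j=1}^{n_p}\mathcal A_{i-j+1}*\mathcal B_j$ (indices modulo $n_p$ in $\{1,\dots,n_p\}$), where for matrices $*$ is the ordinary matrix product. The transpose is defined recursively by $(\mathcal A^T)_1=(\mathcal A_1)^T$ and $(\mathcal A^T)_i=(\mathcal A_{n_p+2-i})^T$ for $2\le i\le n_p$, with the ordinary transpose for matrices. With these operations $R$ is an associative ring with unity $\mathcal I$ (the tensor whose slice $\mathcal I(:,:,1,\dots,1)$ is the identity matrix and whose other slices are zero), and $(\mathcal A*\mathcal B)^T=\mathcal B^T*\mathcal A^T$. A tensor is lower triangular if each of its $n\times n$ slices $\mathcal L(:,:,i_3,\dots,i_p)$ is a lower triangular matrix. Invertibility is in the ring $R$, and $\mathcal C^{-2}=\mathcal C^{-1}*\mathcal C^{-1}$. The Moore-Penrose inverse $\mathcal A^\dagger$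 of $\mathcal A$ is the unique $\mathcal Z\in R$ satisfying (1) $\mathcal A*\mathcal Z*\mathcal A=\mathcal A$; (2) $\mathcal Z*\mathcal A*\mathcal Z=\mathcal Z$; (3) $(\mathcal A*\mathcal Z)^T=\mathcal A*\mathcal Z$; (4) $(\mathcal Z*\mathcal A)^T=\mathcal Z*\mathcal A$. *)

(* Defs.v *)
From HB Require Import structures.
From mathcomp Require Import all_boot all_order all_algebra.
From mathcomp Require Import boolp reals.

Set Implicit Arguments.
Unset Strict Implicit.
Unset Printing Implicit Defensive.

Import GRing.Theory.
Local Open Scope ring_scope.

(* One step of the recursion defining tensors: families (A_i) of elements of S
   under circular convolution. It is an alias because {ffun _ -> S} is already
   a ring, for the pointwise product. Indices are 0-based elements of the
   cyclic group 'I_m.+1, so the 1-based index i - j + 1 modulo m.+1 is i - j. *)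
Definition circ (m : nat) (S : Type) := {ffun 'I_m.+1 -> S}.

HB.instance Definition _ (m : nat) (S : zmodType) :=
  GRing.Zmodule.copy (circ m S) {ffun 'I_m.+1 -> S}.

Section CircRing.
Variables (m : nat) (S : nzRingType).
Implicit Types A B C : circ m S.

Definition circ_one : circ m S := [ffun i => if i == 0 then 1 else 0].

Definition circ_mul A B : circ m S := [ffun i => \sum_j A (i - j) * B j].

Fact circ_mulA : associative circ_mul.
Proof.
move=> A B C; apply/ffunP => i; rewrite !ffunE.
under eq_bigr => j _ do rewrite ffunE mulr_sumr.
under [RHS]eq_bigr => j _ do rewrite ffunE mulr_suml.
rewrite exchange_big /=; apply: eq_bigr => k _.
rewrite (reindex_inj (addIr k)) /=; apply: eq_bigr => j _.
by rewrite addrK mulrA opprD [- j - k]addrC addrA.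
Qed.

Fact circ_mul1 : left_id circ_one circ_mul.
Proof.
move=> A; apply/ffunP => i; rewrite !ffunE (bigD1 i) //= big1 => [|j].
  by rewrite ffunE subrr eqxx mul1r addr0.
by rewrite ffunE subr_eq0 eq_sym => /negPf ->; rewrite mul0r.
Qed.

Fact circ_mulr1 : right_id circ_one circ_mul.
Proof.
move=> A; apply/ffunP => i; rewrite !ffunE (bigD1 0) //= big1 => [|j].
  by rewrite ffunE eqxx subr0 mulr1 addr0.
by rewrite ffunE => /negPf ->; rewrite mulr0.
Qed.

Fact circ_mulDl : left_distributive circ_mul +%R.
Proof.
move=> A B C; apply/ffunP => i; rewrite !ffunE -big_split /=.
by apply: eq_bigr => j _; rewrite ffunE mulrDl.
Qed.

Fact circ_mulDr : right_distributive circ_mul +%R.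
Proof.
move=> A B C; apply/ffunP => i; rewrite !ffunE -big_split /=.
by apply: eq_bigr => j _; rewrite ffunE mulrDr.
Qed.

Fact circ_one_neq0 : circ_one != 0.
Proof. by apply/eqP => /ffunP/(_ 0)/eqP; rewrite !ffunE eqxx oner_eq0. Qed.

HB.instance Definition _ := GRing.Zmodule_isNzRing.Build (circ m S)
  circ_mulA circ_mul1 circ_mulr1 circ_mulDl circ_mulDr circ_one_neq0.

Definition circ_unit : {pred circ m S} :=
  fun A => `[< exists B : circ m S, B * A = 1 /\ A * B = 1 >].

(* Off the units the value is irrelevant; MathComp requires it to be A. *)
Definition circ_inv A : circ m S :=
  match pselect (exists B : circ m S, B * A = 1 /\ A * B = 1) with
  | left AU => sval (cid AU)
  | right _ => A
  end.

Fact circ_mulVr : {in circ_unit, left_inverse 1 circ_inv *%R}.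
Proof.
by move=> A /asboolP AU; rewrite /circ_inv; case: pselect => // E; case: cid => B [].
Qed.

Fact circ_divrr : {in circ_unit, right_inverse 1 circ_inv *%R}.
Proof.
by move=> A /asboolP AU; rewrite /circ_inv; case: pselect => // E; case: cid => B [].
Qed.

Fact circ_unitP A B : B * A = 1 /\ A * B = 1 -> A \in circ_unit.
Proof. by move=> AB; apply/asboolP; exists B. Qed.

Fact circ_inv_out : {in [predC circ_unit], circ_inv =1 id}.
Proof.
by move=> A /asboolPn AU; rewrite /circ_inv; case: pselect.
Qed.

HB.instance Definition _ := GRing.NzRing_hasMulInverse.Build (circ m S)
  circ_mulVr circ_divrr circ_unitP circ_inv_out.

End CircRing.

Section Tensor.
Variables (R : realType) (n : nat) (d : nat -> nat).

(* The ring of real tensors of order q + 2 and size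
     n.+1 x n.+1 x (d 3).+1 x ... x (d (q + 2)).+1
   under the t-product: positive dimensions are given by their predecessors,
   and d k is only relevant for 3 <= k <= q + 2. The outermost index of a
   tensor is its last one. *)
Fixpoint tensor (q : nat) : unitRingType :=
  match q with
  | 0 => 'M[R]_n.+1
  | q'.+1 => circ (d q'.+3) (tensor q')
  end.

(* With 0-based indices, i = 0 is fixed by - i, and for i != 0 the value of
   - i is the size minus i. *)
Fixpoint ttr (q : nat) : tensor q -> tensor q :=
  match q with
  | 0 => fun A : 'M[R]_n.+1 => A^T
  | q'.+1 => fun A : circ (d q'.+3) (tensor q') =>
      [ffun i => ttr (A (- i))] : circ (d q'.+3) (tensor q')
  end.

(* Multi-indices (i_3, ..., i_(q+2)). *)
Fixpoint tindex (q : nat) : Type :=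
  match q with
  | 0 => unit
  | q'.+1 => (tindex q' * 'I_(d q'.+3).+1)%type
  end.

Fixpoint slice (q : nat) : tensor q -> tindex q -> 'M[R]_n.+1 :=
  match q with
  | 0 => fun (A : 'M[R]_n.+1) _ => A
  | q'.+1 => fun (A : circ (d q'.+3) (tensor q')) (i : tindex q' * _) =>
      slice (A i.2) i.1
  end.

(* [is_trig_mx] is lower triangularity. *)
Definition lower_triangular (q : nat) (A : tensor q) : Prop :=
  forall i : tindex q, is_trig_mx (slice A i).

Definition penrose (q : nat) (A Z : tensor q) : Prop :=
  [/\ A * Z * A = A, Z * A * Z = Z, ttr (A * Z) = A * Z
    & ttr (Z * A) = Z * A].

Definition is_MP_inverse (q : nat) (A Z : tensor q) : Prop :=
  unique (penrose A) Z.

End Tensor.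

(* Main.v *)
Require Import Defs.
From HB Require Import structures.
From mathcomp Require Import all_boot all_order all_algebra.
From mathcomp Require Import boolp reals.

Set Implicit Arguments.
Unset Strict Implicit.
Unset Printing Implicit Defensive.

Import GRing.Theory Num.Theory.
Local Open Scope ring_scope.

(** Tensors form a ring with a proper involution: [X * ttr X = 0] forces
    [X = 0] ([ttr_proper]), because the trace of the matrix slice of
    [X * ttr X] at the multi-index 0 is the sum of the squares of all the
    entries of [X].  The rest of the argument is algebra in such a ring.

    Put [U = ttr L * L], a self-adjoint unit, and [P = L * U^-1 * ttr L], a
    self-adjoint idempotent with [P * L = L].  The candidate
    [Z = ttr A * L * U^-2 * ttr L] satisfies [A * Z = P] since
    [A * ttr A = L * ttr L], and [Z * A] has the form
    [ttr (ttr L * A) * U^-2 * (ttr L * A)]; this gives the two symmetry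
    conditions, and [Z * A * Z = Z] reduces to [ttr L * P = ttr L].  The only
    condition that needs properness is [A * Z * A = A], that is [P * A = A]:
    with [X = A - P * A],
      [X * ttr X = (1 - P) * L * ttr L * (1 - P) = 0].
    Uniqueness is Penrose's classical argument ([penrose_inj]). *)

Section Transpose.
Variables (R : realType) (n : nat) (d : nat -> nat).
Local Notation tensor := (tensor R n d).

Lemma ttrK q : involutive (@ttr R n d q).
Proof.
elim: q => [|q IHq] A /=; first exact: trmxK.
by apply/ffunP => i; rewrite !ffunE opprK IHq.
Qed.

Lemma ttr_is_zmod_morphism q : zmod_morphism (@ttr R n d q).
Proof.
elim: q => [|q IHq] A B /=; first exact: raddfB.
by apply/ffunP => i; rewrite !ffunE IHq.
Qed.

HB.instance Definition _ q :=
  GRing.isZmodMorphism.Build (tensor q) (tensor q) (@ttr R n d q)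
    (@ttr_is_zmod_morphism q).

Lemma ttrM q (A B : tensor q) : ttr (A * B) = ttr B * ttr A.
Proof.
elim: q A B => [|q IHq] A B /=; first exact: trmx_mul.
apply/ffunP => i; rewrite !ffunE raddf_sum [RHS](reindex_inj (addIr i)) /=.
by apply: eq_bigr => j _; rewrite !ffunE IHq opprB addrK -opprD [i + j]addrC.
Qed.

Lemma ttr1 q : ttr (1 : tensor q) = 1.
Proof. by rewrite -[ttr 1]mulr1 -[in X in _ * X](ttrK 1) -ttrM mulr1 ttrK. Qed.

Lemma ttrV q (U : tensor q) : U \is a GRing.unit -> ttr U = U ->
  ttr U^-1 = U^-1.
Proof.
by move=> Uu Us; apply: (mulIr Uu); rewrite -{2}Us -ttrM divrr ?ttr1 ?mulVr.
Qed.

(** The trace of the matrix slice at the multi-index 0: the linear form that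
    turns [X * ttr Y] into the Euclidean inner product of [X] and [Y]. *)
Fixpoint trace0 (q : nat) : tensor q -> R :=
  match q with
  | 0 => fun A : 'M[R]_n.+1 => \tr A
  | q'.+1 => fun A : circ (d q'.+3) (tensor q') => trace0 (A 0)
  end.

Lemma trace0_is_zmod_morphism q : zmod_morphism (@trace0 q).
Proof.
elim: q => [|q IHq] A B /=; first exact: raddfB.
by rewrite !ffunE IHq.
Qed.

HB.instance Definition _ q :=
  GRing.isZmodMorphism.Build (tensor q) R (@trace0 q)
    (@trace0_is_zmod_morphism q).

(** Slice 0 of [A * ttr A] is the sum of the [A (- j) * ttr (A (- j))], since
    [ttr] negates the last index just as the convolution does at 0. *)
Lemma trace0_mul_ttr q (A : tensor q.+1) :
  trace0 (A * ttr A) =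
    \sum_i trace0 ((A : circ _ (tensor q)) i * ttr ((A : circ _ (tensor q)) i)).
Proof.
rewrite /= ffunE raddf_sum [RHS](reindex_inj oppr_inj) /=.
by apply: eq_bigr => j _; rewrite ffunE sub0r.
Qed.

Lemma mxtrace_mul_tr (A : 'M[R]_n.+1) :
  \tr (A *m A^T) = \sum_i \sum_j A i j ^+ 2.
Proof.
by apply: eq_bigr => i _; rewrite mxE; apply: eq_bigr => j _; rewrite mxE expr2.
Qed.

Lemma trace0_mul_ttr_ge0 q (A : tensor q) : 0 <= trace0 (A * ttr A).
Proof.
elim: q A => [|q IHq] A.
  rewrite [X in _ <= X]mxtrace_mul_tr.
  apply: sumr_ge0 => i _; apply: sumr_ge0 => j _.
  exact: sqr_ge0.
by rewrite trace0_mul_ttr; apply: sumr_ge0 => i _; apply: IHq.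
Qed.

Lemma trace0_mul_ttr_eq0 q (A : tensor q) : trace0 (A * ttr A) = 0 -> A = 0.
Proof.
elim: q A => [|q IHq] A.
  rewrite [LHS]mxtrace_mul_tr => A0; apply/matrixP => i j; rewrite mxE.
  have sq_ge0 k l : 0 <= A k l ^+ 2 := sqr_ge0 _.
  have row0 : \sum_l A i l ^+ 2 = 0.
    apply: (psumr_eq0P _ A0) => // k _.
    exact: sumr_ge0.
  apply/eqP; rewrite -sqrf_eq0; apply/eqP.
  exact: (psumr_eq0P _ row0).
rewrite trace0_mul_ttr => A0; apply/ffunP => i; rewrite ffunE; apply: IHq.
exact: (psumr_eq0P (fun k _ => trace0_mul_ttr_ge0 _) A0).
Qed.

Lemma ttr_proper q (X : tensor q) : X * ttr X = 0 -> X = 0.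
Proof. by move=> X0; apply: trace0_mul_ttr_eq0; rewrite X0 raddf0. Qed.

End Transpose.

(** [A * Y] and [A * Z] are projections with the same range, both orthogonal,
    hence equal; likewise [Y * A] and [Z * A] have the same kernel.  Then
    [Y = Y * A * Y = Z * A * Y = Z * A * Z = Z]. *)
Lemma penrose_inj (R : realType) n d q (A Y Z : tensor R n d q) :
  penrose A Y -> penrose A Z -> Y = Z.
Proof.
move=> [AYA YAY AYs YAs] [AZA ZAZ AZs ZAs].
have AYZ : A * Y = A * Z.
  by rewrite -{1}AZA -mulrA -[LHS]ttrK ttrM AYs AZs mulrA AYA AZs.
have YZA : Y * A = Z * A.
  by rewrite -{1}AZA -(mulrA A) mulrA -[LHS]ttrK ttrM YAs ZAs -mulrA (mulrA A)
    AYA ZAs.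
by rewrite -YAY YZA -mulrA AYZ mulrA.
Qed.

(** [(C * A) * ttr (C * A)] depends on [A] only through [A * ttr A], so by
    properness [A * ttr A] determines the left annihilator of [A].  Used with
    [C = 1 - P], where [P] is the projection onto the range of [L]. *)
Lemma mulr_eq0_of_gram (R : realType) n d q (A L C : tensor R n d q) :
  A * ttr A = L * ttr L -> C * L = 0 -> C * A = 0.
Proof.
move=> AL CL; apply: ttr_proper.
by rewrite ttrM mulrA -[C * A * _]mulrA AL mulrA CL !mul0r.
Qed.

Lemma penrose_gram_factor (R : realType) n d q (A L : tensor R n d q) :
  A * ttr A = L * ttr L -> ttr L * L \is a GRing.unit ->
  penrose A (ttr A * L * ((ttr L * L)^-1 * (ttr L * L)^-1) * ttr L).
Proof.
move=> AL; set U := ttr L * L => Uu.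
have Us : ttr U = U by rewrite /U ttrM ttrK.
have Vs := ttrV Uu Us.
set V := U^-1 in Vs *; set Z := _ * ttr L.
have AZ : A * Z = L * V * ttr L.
  by rewrite /Z !mulrA AL -[L * ttr L * L]mulrA -/U mulrK.
have PA : L * V * ttr L * A = A.
  apply/eqP; rewrite -subr_eq0 -{2}[A]mul1r -mulrBl; apply/eqP.
  apply: mulr_eq0_of_gram AL _.
  by rewrite mulrBl mul1r -[L * V * _ * L]mulrA -/U divrK ?subrr.
split.
- by rewrite AZ PA.
- by rewrite -mulrA AZ /Z !mulrA -[_ * ttr L * L]mulrA -/U divrK.
- by rewrite AZ !ttrM ttrK Vs mulrA.
- by rewrite /Z !ttrM !ttrK Vs !mulrA.
Qed.

Unset Implicit Arguments.
Set Strict Implicit.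

Theorem theorem17 (R : realType) (p n : nat) (d : nat -> nat)
    (hp : (3 <= p)%N) (A L : tensor R n d p.-2)
    (hL : lower_triangular L)
    (hAL : A * ttr A = L * ttr L)
    (hU : ttr L * L \is a GRing.unit) :
  is_MP_inverse A
    (ttr A * L * ((ttr L * L)^-1 * (ttr L * L)^-1) * ttr L).
Proof.
have penZ := penrose_gram_factor hAL hU.
by split=> // Y; apply: penrose_inj.
Qed.
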